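(* Consider the one-dimensional shallow water equations $W_t+F(W)_x=G(x,W)$ with bottom function $b$. The time splitting scheme Q-tra1 defined in the context satisfies the Approximate C-property: when it is applied to the stationary Problem SP (water at rest: $q=0$, $h=H(x)$, $b(x)+H(x)=A$ constant), it is accurate to order $\Delta x^2$. That is, if $H$ is smooth and positive, $b=A-H$, $W_j^n=(H(x_j),0)^T$ for all $j$, and $W_j^{n+1}=(h_j^{n+1},q_j^{n+1})^T$ is the result of one time step of Q-tra1 with $\Delta t=O(\Delta x)$, then $$h_j^{n+1}-H(x_j)=O(\Delta x^2),\qquad q_j^{n+1}=O(\Delta x^2)\qquad\text{as }\Delta x\to 0,$$ uniformly for $x_j$ in compact sets.
   Context: **Equations.** Let $g>0$ be the gravitational constant and $b:\mathbb{R}\to\mathbb{R}$ the bottom function. The unknown is $W=(h,q)^T$ with water height $h>0$ and flow per unit length $q$, and $$F(W)=\begin{pmatrix} q\\ \frac{q^2}{h}+\frac12 g h^2\end{pmatrix},\qquad G(x,W)=\begin{pmatrix}0\\ -g h b'(x)\end{pmatrix}.$$ The Jacobian of $F$ is $A(W)=\begin{pmatrix}0&1\\ -\frac{q^2}{h^2}+gh & \frac{2q}{h}\end{pmatrix}=X\Lambda X^{-1}$ with $\Lambda=\mathrm{diag}(\lambda_1,\lambda_2)$, $\lambda_1=\frac qh+\sqrt{gh}$, $\lambda_2=\frac qh-\sqrt{gh}$, $X=\begin{pmatrix}1&1\\ \lambda_1&\lambda_2\end{pmatrix}$. Write $|A(W)|=X|\Lambda|X^{-1}$ with $|\Lambda|=\mathrm{diag}(|\lambda_1|,|\lambda_2|)$.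 **Grid.** Uniform space step $\Delta x>0$, nodes $x_j$ with $x_{j+1}-x_j=\Delta x$ ($j\in\mathbb{Z}$), and time step $\Delta t=t^{n+1}-t^n>0$. $W_j^n=(h_j^n,q_j^n)^T$ denotes the discrete solution at $(x_j,t^n)$. **Scheme Q-tra1.** One time step $W^n\mapsto W^{n+1}$ is as follows. 1. (Homogeneous step, Q-scheme of van Leer.) With $$F_{j+1/2}=\frac{F(W_j^n)+F(W_{j+1}^n)}{2}-\frac12\left|A\!\left(\frac{W_j^n+W_{j+1}^n}{2}\right)\right|(W_{j+1}^n-W_j^n),$$ set $\widehat W_j^{n+1}=(\hat h_j,\hat q_j)^T=W_j^n-\frac{\Delta t}{\Delta x}\left(F_{j+1/2}-F_{j-1/2}\right)$. 2. (Source step, trapezoidal rule.) Set $$h_j^{n+1}=\hat h_j,\qquad q_j^{n+1}=\hat q_j-g\,b'(x_j)\,\frac{\Delta t}{2}\left(h_j^n+\hat h_j\right).$$ **Problem SP.** The stationary problem representing water at rest: $q(x,t)=0$, $h(x,t)=H(x)$, with $b(x)+H(x)=A$ for a constant $A$. **Approximate C-property.** A scheme satisfies the Approximate C-property if it is accurate to order $\Delta x^2$ when applied to Problem SP. *)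

(* Defs.v *)
From HB Require Import structures.
From mathcomp Require Import all_boot all_order all_algebra.
From mathcomp Require Import all_classical all_reals all_analysis.
From mathcomp Require Import ring lra.

Set Implicit Arguments.
Unset Strict Implicit.
Unset Printing Implicit Defensive.

Import Order.TTheory GRing.Theory Num.Theory.
Import numFieldNormedType.Exports.
Local Open Scope classical_set_scope.
Local Open Scope ring_scope.

Section ShallowWater.
Context {R : realType}.
Implicit Types (g : R) (b H : R -> R) (W : 'cV[R]_2).

Definition vec2 (u v : R) : 'cV[R]_2 := \col_(i < 2) (if i == 0 then u else v).

Definition mat2 (a b c d : R) : 'M[R]_2 :=
  \matrix_(i < 2, j < 2)
    (if i == 0 then (if j == 0 then a else b) else (if j == 0 then c else d)).

Definition height W : R := W 0 0.
Definition flow W : R := W 1 0.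

Definition flux g W : 'cV[R]_2 :=
  vec2 (flow W) (flow W ^+ 2 / height W + 2^-1 * g * height W ^+ 2).

Definition jac g W : 'M[R]_2 :=
  mat2 0 1
       (- (flow W ^+ 2 / height W ^+ 2) + g * height W)
       (2 * flow W / height W).

Definition lambda1 g W : R := flow W / height W + Num.sqrt (g * height W).
Definition lambda2 g W : R := flow W / height W - Num.sqrt (g * height W).

Definition eigvecs g W : 'M[R]_2 := mat2 1 1 (lambda1 g W) (lambda2 g W).
Definition eigvals g W : 'M[R]_2 := mat2 (lambda1 g W) 0 0 (lambda2 g W).
Definition abs_eigvals g W : 'M[R]_2 :=
  mat2 `|lambda1 g W| 0 0 `|lambda2 g W|.

(* invmx is the true inverse here because lambda1 != lambda2 when g, h > 0. *)
Definition abs_jac g W : 'M[R]_2 :=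
  eigvecs g W *m abs_eigvals g W *m invmx (eigvecs g W).

Lemma eigvecs_unit g W : 0 < g -> 0 < height W -> eigvecs g W \in unitmx.
Proof.
move=> g0 h0; rewrite unitmxE (expand_det_row _ 0) !big_ord_recl big_ord0.
rewrite /cofactor !det_mx11 !mxE /= unitfE.
have s0 : 0 < Num.sqrt (g * height W) by rewrite sqrtr_gt0 mulr_gt0.
rewrite /bump /= /lambda1 /lambda2; apply/negP => /eqP.
by rewrite !addn0 !expr0 !mul1r addr0 expr1; lra.
Qed.

Lemma jac_diag g W : 0 < g -> 0 < height W ->
  jac g W = eigvecs g W *m eigvals g W *m invmx (eigvecs g W).
Proof.
move=> g0 h0; apply: (canRL (mulmxK (eigvecs_unit g0 h0))).
have s2 : Num.sqrt (g * height W) ^+ 2 = g * height W.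
  by rewrite sqr_sqrtr// ltW// mulr_gt0.
have hn : height W != 0 by rewrite gt_eqF.
apply/matrixP => i j; rewrite !mxE !big_ord_recl !big_ord0 !mxE.
case: i => [[|[|//]] ?]; case: j => [[|[|//]] ?] /=;
  rewrite /lambda1 /lambda2; move: s2; set s := Num.sqrt _ => s2;
  try ring; by rewrite -s2; field.
Qed.

(* F_{j+1/2} of the van Leer Q-scheme is vanLeer_flux g W_j W_{j+1}. *)
Definition vanLeer_flux g (Wl Wr : 'cV[R]_2) : 'cV[R]_2 :=
  2^-1 *: (flux g Wl + flux g Wr)
  - 2^-1 *: (abs_jac g (2^-1 *: (Wl + Wr)) *m (Wr - Wl)).

Definition Qscheme_step g (dx dt : R) (W : int -> 'cV[R]_2) (j : int) :
    'cV[R]_2 :=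
  W j - (dt / dx) *: (vanLeer_flux g (W j) (W (j + 1))
                      - vanLeer_flux g (W (j - 1)) (W j)).

(* One time step of a scheme: bottom b, nodes x, space step dx, time step dt,
   and discrete data W^n, giving W^{n+1}. *)
Definition scheme : Type :=
  forall (b : R -> R) (x : int -> R) (dx dt : R) (W : int -> 'cV[R]_2),
    int -> 'cV[R]_2.

Definition Qtra1 g : scheme := fun b x dx dt (W : int -> 'cV[R]_2) j =>
  let What := Qscheme_step g dx dt W j in
  vec2 (height What)
       (flow What
        - g * derive1 b (x j) * (dt / 2) * (height (W j) + height What)).

Definition smooth (f : R -> R) : Prop :=
  forall (n : nat) (y : R), derivable (derive1n n f) y 1.

Definition uniform_grid (dx : R) (x : int -> R) : Prop :=
  forall j : int, x (j + 1) - x j = dx.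

Definition rest_state H (y : R) : 'cV[R]_2 := vec2 (H y) 0.

(* dt = O(dx) is the bound dt <= C * dx with C arbitrary but fixed.  The
   constant M and the threshold on dx depend only on the problem, C and K, and
   not on dt, the position of the grid or the node. *)
Definition approx_C_property (S : scheme) : Prop :=
  forall (b H : R -> R) (A : R),
    smooth H -> (forall y, 0 < H y) -> (forall y, b y + H y = A) ->
  forall (C : R) (K : set R), compact K ->
  exists M : R, \forall dx \near 0^'+,
    forall (dt : R) (x : int -> R),
      0 < dt -> dt <= C * dx -> uniform_grid dx x ->
    let W0 := fun j => rest_state H (x j) in
    let W1 := S b x dx dt W0 in
    forall j : int, K (x j) ->
      `|height (W1 j) - H (x j)| <= M * dx ^+ 2 /\
      `|flow (W1 j)| <= M * dx ^+ 2.

End ShallowWater.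

Arguments scheme : clear implicits.

(* Main.v *)
Require Import Defs.
From mathcomp Require Import all_boot all_order all_algebra.
From mathcomp Require Import all_classical all_reals all_analysis.
From mathcomp Require Import ring lra.
Import Order.TTheory GRing.Theory Num.Theory.
Import numFieldNormedType.Exports.
Local Open Scope ring_scope.


(** On water at rest the velocity vanishes, so at every interface the two
    characteristic speeds are opposite, lambda = +c and -c with
    c = sqrt (g * hbar), where hbar is the mean of the two neighbouring heights.
    Hence |A| = c * Id, and the step becomes explicit
    ([abs_jac_rest], [Qscheme_step_rest]).  With r = dt/dx and the nodal
    heights hm, h0, hp at x_(j-1), x_j, x_(j+1):

      hhat - h0 = r/2 * (c_+ * (hp - h0) - c_- * (h0 - hm)),
      q'        = - r * g/4 * (hp^2 - hm^2) + g * H' * dt/2 * (h0 + hhat),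

    the last sign because b' = - H'.

    Height: the bracket is c_+ times a second difference of H, which is
    O(dx^2), plus (c_+ - c_-) times a first difference; the speeds differ by
    O(dx) because sqrt is Lipschitz away from 0 and H is bounded below by a
    positive constant near the compact set.  So the numerical viscosity, of
    size O(dx) at each single interface, cancels to O(dx^2)
    ([height_defect_le]).

    Flow: up to (dt/2) * g * H' * (hhat - h0), already controlled by the height
    estimate, q' is the difference between the centered difference of
    g/2 * H^2 and g * H * H' at x_j, multiplied by dt ([flow_defect_le]).

    All constants depend only on bounds for H, 1/H, H', H'' on the closed
    1-neighbourhood of the compact set, which contains the stencil as soon as
    dx <= 1; this gives uniformity in the node and in the grid. *)

(** * The scheme on water at rest *)

Lemma height_vec2 {R : realType} (u v : R) : height (vec2 u v) = u.
Proof. by rewrite /height mxE. Qed.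

Lemma flow_vec2 {R : realType} (u v : R) : flow (vec2 u v) = v.
Proof. by rewrite /flow mxE. Qed.

Definition wave_speed {R : realType} (g a b : R) : R :=
  Num.sqrt (g * (2^-1 * (a + b))).

(** At zero flow the eigenvalues are opposite, so |Lambda| is scalar and the
    conjugation by the eigenvectors disappears. *)
Lemma abs_jac_rest {R : realType} (g h : R) : 0 < g -> 0 < h ->
  abs_jac g (vec2 h 0) = (Num.sqrt (g * h))%:M.
Proof.
move=> g0 h0; rewrite /abs_jac.
have -> : abs_eigvals g (vec2 h 0) = (Num.sqrt (g * h))%:M.
  apply/matrixP => i j; rewrite !mxE.
  rewrite /lambda1 /lambda2 height_vec2 flow_vec2 mul0r add0r sub0r normrN.
  rewrite (ger0_norm (sqrtr_ge0 _)).
  by case: i => [[|[|//]] ?]; case: j => [[|[|//]] ?].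
by rewrite mul_mx_scalar -scalemxAl mulmxV ?scalemx1// eigvecs_unit// height_vec2.
Qed.

Lemma vanLeer_flux_rest {R : realType} (g a b : R) : 0 < g -> 0 < a -> 0 < b ->
  vanLeer_flux g (vec2 a 0) (vec2 b 0) =
  vec2 (- (2^-1 * (wave_speed g a b * (b - a)))) (g / 4 * (a ^+ 2 + b ^+ 2)).
Proof.
move=> g0 a0 b0; rewrite /vanLeer_flux.
have -> : 2^-1 *: (vec2 a 0 + vec2 b 0) = vec2 (2^-1 * (a + b)) 0.
  by apply/matrixP => i j; rewrite !mxE; case: ifP => //; rewrite addr0 mulr0.
rewrite abs_jac_rest//; last by rewrite mulr_gt0// addr_gt0.
rewrite mul_scalar_mx /flux !height_vec2 !flow_vec2 /wave_speed.
by apply/matrixP => i j; rewrite !mxE; case: ifP => _; field; rewrite ?gt_eqF.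
Qed.

Lemma Qscheme_step_rest {R : realType} (g dx dt : R) (h : int -> R) (j : int) :
  0 < g -> (forall i, 0 < h i) ->
  Qscheme_step g dx dt (fun i => vec2 (h i) 0) j =
  vec2 (h j + dt / dx / 2 * (wave_speed g (h j) (h (j + 1)) * (h (j + 1) - h j)
            - wave_speed g (h (j - 1)) (h j) * (h j - h (j - 1))))
       (- (dt / dx * (g / 4 * (h (j + 1) ^+ 2 - h (j - 1) ^+ 2)))).
Proof.
move=> g0 h0; rewrite /Qscheme_step !vanLeer_flux_rest//.
by apply/matrixP => i k; rewrite !mxE; case: ifP => _; lra.
Qed.

(** * Taylor estimates and bounds near a compact set *)

(** Recording the intermediate point by its distance to [x] avoids
    distinguishing forward from backward neighbours of a node. *)
Lemma MVT_centered {R : realType} (f : R -> R) (x y : R) :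
  (forall z : R, derivable f z 1) ->
  exists2 c, `|c - x| <= `|y - x| & f y - f x = derive1 f c * (y - x).
Proof.
move=> df.
have isd (z : R) : is_derive z 1 f (derive1 f z) by rewrite derive1E; exact: derivableP.
have ctf a b : {within `[a, b], continuous f}%classic.
  by apply: derivable_within_continuous => z _; exact: df.
have [xy|/ltW yx] := leP x y.
  have [c] := MVT_segment xy (fun z _ => isd z) (ctf x y).
  rewrite in_itv/= => /andP[xc cy] e; exists c => //.
  by rewrite !ger0_norm ?subr_ge0// lerD2r.
have [c] := MVT_segment yx (fun z _ => isd z) (ctf y x).
rewrite in_itv/= => /andP[yc cx] e; exists c; last by lra.
by rewrite !ler0_norm ?subr_le0// !opprB lerD2l lerN2.
Qed.

(** Two applications of the mean value theorem, instead of a Taylor expansion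
    with remainder, cost only the factor 1/2. *)
Lemma taylor1_bound {R : realType} (f : R -> R) (x y L : R) :
  (forall z : R, derivable f z 1) -> (forall z : R, derivable (derive1 f) z 1) ->
  (forall z, `|z - x| <= `|y - x| -> `|derive1 (derive1 f) z| <= L) ->
  `|f y - f x - derive1 f x * (y - x)| <= L * (y - x) ^+ 2.
Proof.
move=> df ddf f2L; have [c cy ->] := MVT_centered f x y df.
rewrite -mulrBl; have [e ec ->] := MVT_centered _ x c ddf.
rewrite !normrM -mulrA -real_normK ?num_real// expr2; apply: ler_pM; rewrite ?mulr_ge0//.
- exact/f2L/(le_trans ec).
- by rewrite ler_wpM2r.
Qed.

(** Stated with an attained minimum [f c], so that positivity of [f] yields a
    positive lower bound. *)
Lemma min_near_compact {R : realType} (f : R -> R) (K : set R) :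
  compact K -> continuous f ->
  exists c, forall x z, K x -> `|z - x| <= 1 -> f c <= f z.
Proof.
move=> /compact_bounded[N [_ KN]] cf.
(* Points of K have norm at most |N| + 1, their neighbours one more. *)
pose B := `|N| + 2.
have B0 : - B <= B by rewrite /B; have := normr_ge0 N; lra.
have [c _ fc] := EVT_min B0 (continuous_subspaceT cf).
exists c => x z Kx zx; apply: fc.
have xN : `|x| <= `|N| + 1.
  by apply: (KN (`|N| + 1)) Kx; have := ler_norm N; lra.
rewrite in_itv/= -ler_norml; have -> : z = (z - x) + x by rewrite subrK.
by apply: (le_trans (ler_normD _ _)); rewrite /B; lra.
Qed.

Lemma bounded_near_compact {R : realType} (f : R -> R) (K : set R) :
  compact K -> continuous f ->
  exists L, forall x z, K x -> `|z - x| <= 1 -> `|f z| <= L.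
Proof.
move=> cK cf; have cNf : continuous (fun z => - `|f z|).
  by move=> z; apply: cvgN; apply: cvg_norm; exact: cf.
have [c fc] := min_near_compact _ K cK cNf.
by exists `|f c| => x z Kx zx; rewrite -lerN2; exact: fc Kx zx.
Qed.

(** * Local defects of the height and of the flow *)

(** The conjugate identity: u - v is the difference of the square roots times
    their sum, and that sum is at least 2 * sqrt w. *)
Lemma sqrt_lipschitz {R : realType} (w u v : R) : 0 < w -> w <= u -> w <= v ->
  `|Num.sqrt u - Num.sqrt v| <= `|u - v| / (2 * Num.sqrt w).
Proof.
move=> w0 wu wv; have sw0 : 0 < Num.sqrt w by rewrite sqrtr_gt0.
have u0 : 0 <= u := le_trans (ltW w0) wu.
have v0 : 0 <= v := le_trans (ltW w0) wv.
have swu : Num.sqrt w <= Num.sqrt u by rewrite ler_sqrt.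
have swv : Num.sqrt w <= Num.sqrt v by rewrite ler_sqrt.
rewrite ler_pdivlMr ?mulr_gt0//.
have -> : u - v = (Num.sqrt u - Num.sqrt v) * (Num.sqrt u + Num.sqrt v).
  by rewrite -subr_sqr !sqr_sqrtr.
rewrite normrM ler_wpM2l// ger0_norm; first lra.
by rewrite addr_ge0 ?sqrtr_ge0.
Qed.

Lemma normM_le {R : realType} (a b A B : R) :
  `|a| <= A -> `|b| <= B -> `|a * b| <= A * B.
Proof. by move=> aA bB; rewrite normrM ler_pM. Qed.

Lemma normD_le {R : realType} (a b A B : R) :
  `|a| <= A -> `|b| <= B -> `|a + b| <= A + B.
Proof. by move=> aA bB; apply: (le_trans (ler_normD _ _)); exact: lerD. Qed.

(** [m] bounds the heights from below, [L] bounds H, |H'| and |H''|, and [C]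
    bounds the ratio dt / dx.  The first summand bounds the contribution of the
    second difference of H, the second one that of the variation of the wave
    speed. *)
Definition height_const {R : realType} (g C L m : R) : R :=
  C / 2 * (Num.sqrt (g * L) * (2 * L) + g * L / (2 * Num.sqrt (g * m)) * L).

(** Each of the two viscous terms is only O(dx); the estimate comes from their
    difference, written by discrete summation by parts as
    c_+ * (second difference) + (c_+ - c_-) * (first difference). *)
Lemma height_defect_le {R : realType} (g C L m r dx hm h0 hp : R) :
  0 < g -> 0 < m -> 0 <= r <= C ->
  m <= hm <= L -> m <= h0 <= L -> m <= hp <= L ->
  `|hp - h0| <= L * dx -> `|h0 - hm| <= L * dx ->
  `|(hp - h0) - (h0 - hm)| <= 2 * L * dx ^+ 2 ->
  `|r / 2 * (wave_speed g h0 hp * (hp - h0)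
             - wave_speed g hm h0 * (h0 - hm))|
  <= height_const g C L m * dx ^+ 2.
Proof.
move=> g0 m0 /andP[r0 rC] hmL h0L hpL dp dm d2.
set cp := wave_speed g h0 hp; set cm := wave_speed g hm h0.
have cpL : `|cp| <= Num.sqrt (g * L).
  rewrite ger0_norm ?sqrtr_ge0// ler_sqrt; last by rewrite mulr_ge0; lra.
  by rewrite ler_pM2l//; lra.
have dc : `|cp - cm| <= g * L / (2 * Num.sqrt (g * m)) * dx.
  apply: (le_trans (sqrt_lipschitz (g * m) _ _ _ _ _)).
  - by rewrite mulr_gt0.
  - by rewrite ler_pM2l//; lra.
  - by rewrite ler_pM2l//; lra.
  rewrite mulrAC ler_wpM2r ?invr_ge0 ?mulr_ge0 ?sqrtr_ge0//.
  rewrite -mulrBr normrM gtr0_norm// -mulrA ler_pM2l//.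
  have -> : 2^-1 * (h0 + hp) - 2^-1 * (hm + h0) = 2^-1 * ((hp - h0) + (h0 - hm)).
    by field.
  have -> : L * dx = 2^-1 * (L * dx + L * dx) by field.
  by apply: normM_le; [rewrite ger0_norm|exact: normD_le].
have -> : height_const g C L m * dx ^+ 2 =
  C / 2 * (Num.sqrt (g * L) * (2 * L * dx ^+ 2)
           + g * L / (2 * Num.sqrt (g * m)) * dx * (L * dx)).
  by rewrite /height_const; ring.
have -> : cp * (hp - h0) - cm * (h0 - hm) =
  cp * (hp - h0 - (h0 - hm)) + (cp - cm) * (h0 - hm) by ring.
apply: normM_le; first by rewrite ger0_norm; lra.
by apply: normD_le; exact: normM_le.
Qed.

(** The centered difference of H^2 against its derivative 2 * H * H', with
    [p] standing for H'.  Factoring hp^2 - hm^2 reduces the error to those of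
    the difference hp - hm and of the sum hp + hm; a first order bound suffices
    for the latter, since it is multiplied by 2 * p * dx. *)
Lemma sqr_centered_difference_le {R : realType} (L p dx hm h0 hp : R) :
  0 < dx -> `|p| <= L -> 0 <= hm <= L -> 0 <= hp <= L ->
  `|hp - h0| <= L * dx -> `|h0 - hm| <= L * dx ->
  `|hp - h0 - p * dx| <= L * dx ^+ 2 -> `|h0 - hm - p * dx| <= L * dx ^+ 2 ->
  `|hp ^+ 2 - hm ^+ 2 - 4 * p * h0 * dx| <= 8 * L ^+ 2 * dx ^+ 2.
Proof.
move=> dx0 pL hmL hpL dp dm tp tm.
have -> : hp ^+ 2 - hm ^+ 2 - 4 * p * h0 * dx =
  ((hp - h0 - p * dx) + (h0 - hm - p * dx)) * (hp + hm)
  + 2 * p * dx * ((hp - h0) + - (h0 - hm)) by ring.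
have -> : 8 * L ^+ 2 * dx ^+ 2 =
  (L * dx ^+ 2 + L * dx ^+ 2) * (L + L) + 2 * L * dx * (L * dx + L * dx) by ring.
apply: normD_le; apply: normM_le.
- exact: normD_le.
- by rewrite ger0_norm; lra.
- by apply: normM_le; [apply: normM_le => //; rewrite ger0_norm|rewrite gtr0_norm].
- by apply: normD_le => //; rewrite normrN.
Qed.

Definition flow_const {R : realType} (g C L m : R) : R :=
  C * (g / 4) * (8 * L ^+ 2) + g * L * (C / 2) * height_const g C L m.

(** The trapezoidal source is the source at the exact height h0, balanced
    against the flux difference by [sqr_centered_difference_le], plus a
    correction proportional to the height defect k - h0. *)
Lemma flow_defect_le {R : realType} (g C L m r p dx hm h0 hp k : R) :
  0 < g -> 0 <= r <= C -> 0 < dx <= 1 ->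
  `|p| <= L -> 0 <= hm <= L -> 0 <= hp <= L ->
  `|hp - h0| <= L * dx -> `|h0 - hm| <= L * dx ->
  `|hp - h0 - p * dx| <= L * dx ^+ 2 -> `|h0 - hm - p * dx| <= L * dx ^+ 2 ->
  `|k - h0| <= height_const g C L m * dx ^+ 2 ->
  `|- (r * (g / 4 * (hp ^+ 2 - hm ^+ 2)))
    + g * p * (r * dx / 2) * (h0 + k)| <= flow_const g C L m * dx ^+ 2.
Proof.
move=> g0 /andP[r0 rC] /andP[dx0 dx1] pL hmL hpL dp dm tp tm kh.
have sq := sqr_centered_difference_le L p dx hm h0 hp dx0 pL hmL hpL
  dp dm tp tm.
have -> : - (r * (g / 4 * (hp ^+ 2 - hm ^+ 2)))
    + g * p * (r * dx / 2) * (h0 + k) =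
  - (r * (g / 4) * (hp ^+ 2 - hm ^+ 2 - 4 * p * h0 * dx))
    + g * p * (r * dx / 2) * (k - h0) by field.
have -> : flow_const g C L m * dx ^+ 2 =
  C * (g / 4) * (8 * L ^+ 2 * dx ^+ 2)
  + g * L * (C / 2) * (height_const g C L m * dx ^+ 2).
  by rewrite /flow_const; ring.
apply: normD_le; [rewrite normrN|]; apply: normM_le => //.
  by apply: normM_le; rewrite ger0_norm//; lra.
apply: normM_le; first by apply: normM_le => //; rewrite gtr0_norm.
have rdx : r * dx <= C by rewrite -[C]mulr1; apply: ler_pM => //; exact: ltW.
by rewrite ger0_norm ?ler_pM2r// divr_ge0// mulr_ge0// ltW.
Qed.

(** * The approximate C-property *)

Theorem proposition1 (R : realType) (g : R) (g_gt0 : 0 < g) :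
  approx_C_property (Qtra1 g).
Proof.
move=> b H A smH H0 bH C K cK.
have dH : forall z : R, derivable H z 1 := smH 0%N.
have dH1 : forall z : R, derivable (derive1 H) z 1 := smH 1%N.
have dH2 : forall z : R, derivable (derive1 (derive1 H)) z 1 := smH 2%N.
have cont f : (forall z : R, derivable f z 1) -> continuous (f : R -> R).
  by move=> df z; apply/differentiable_continuous/derivable1_diffP.
have [c mH] := min_near_compact H K cK (cont _ dH).
have [L0 LH] := bounded_near_compact H K cK (cont _ dH).
have [L1 LH1] := bounded_near_compact _ K cK (cont _ dH1).
have [L2 LH2] := bounded_near_compact _ K cK (cont _ dH2).
pose L := Num.max L0 (Num.max L1 L2).
have L0L : L0 <= L by rewrite le_max lexx.
have L1L : L1 <= L by rewrite !le_max lexx orbT.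
have L2L : L2 <= L by rewrite !le_max lexx !orbT.
have db y : derive1 b y = - derive1 H y.
  have -> : b = cst A - H by apply/funext => z /=; rewrite !fctE -(bH z) addrK.
  rewrite !derive1E deriveB//.
  by rewrite -derive1E derive1_cst sub0r.
(* Nothing here depends on dt or on the grid, only on bounds near K. *)
exists (Num.max (height_const g C L (H c)) (flow_const g C L (H c))).
near=> dx => dt x dt0 dtC ux /= j Kx.
have dx0 : 0 < dx by [].
have dx1 : dx <= 1 by near: dx; apply: nbhs_right_le.
have xp : x (j + 1) = x j + dx by have := ux j; lra.
have xm : x (j - 1) = x j - dx by have := ux (j - 1); rewrite subrK; lra.
have np : `|x (j + 1) - x j| = dx by rewrite xp addrC addKr gtr0_norm.
have nm : `|x (j - 1) - x j| = dx.
  by rewrite xm addrAC subrr add0r normrN gtr0_norm.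
have bnd z : `|z - x j| <= dx -> H c <= H z <= L.
  move=> zx; have zx1 := le_trans zx dx1; rewrite (mH _ _ Kx zx1)/=.
  by rewrite (le_trans (ler_norm _))// (le_trans (LH _ _ Kx zx1)).
have bnd1 z : `|z - x j| <= dx -> `|derive1 H z| <= L.
  by move=> zx; rewrite (le_trans (LH1 _ _ Kx (le_trans zx dx1))).
have bnd2 z : `|z - x j| <= dx -> `|derive1 (derive1 H) z| <= L.
  by move=> zx; rewrite (le_trans (LH2 _ _ Kx (le_trans zx dx1))).
have lip y : `|y - x j| = dx -> `|H y - H (x j)| <= L * dx.
  move=> yx; have [e ey ->] := MVT_centered H (x j) y dH.
  by rewrite normrM yx ler_wpM2r ?(ltW dx0)// bnd1// -yx.
have tay y : `|y - x j| = dx ->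
    `|H y - H (x j) - derive1 H (x j) * (y - x j)| <= L * dx ^+ 2.
  move=> yx; rewrite -[in leRHS]yx real_normK ?num_real//.
  by apply: taylor1_bound => // z; rewrite yx; exact: bnd2.
have b0 : H c <= H (x j) <= L by apply: bnd; rewrite subrr normr0 ltW.
have bp : H c <= H (x (j + 1)) <= L by apply: bnd; rewrite np.
have bm : H c <= H (x (j - 1)) <= L by apply: bnd; rewrite nm.
have pL : `|derive1 H (x j)| <= L by apply: bnd1; rewrite subrr normr0 ltW.
have lp := lip _ np.
have lm : `|H (x j) - H (x (j - 1))| <= L * dx by rewrite distrC; exact: lip.
have tp : `|H (x (j + 1)) - H (x j) - derive1 H (x j) * dx| <= L * dx ^+ 2.
  by have := tay _ np; rewrite {2}xp [x j + dx]addrC addrK.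
have tm : `|H (x j) - H (x (j - 1)) - derive1 H (x j) * dx| <= L * dx ^+ 2.
  have := tay _ nm; rewrite {2}xm -normrN; congr (`|_| <= _); ring.
have t2 : `|H (x (j + 1)) - H (x j) - (H (x j) - H (x (j - 1)))|
    <= 2 * L * dx ^+ 2.
  by move: tp tm; rewrite !ler_norml => /andP[? ?] /andP[? ?]; apply/andP; split; lra.
have rC : 0 <= dt / dx <= C.
  by rewrite ler_pdivrMr// dtC andbT divr_ge0// ltW.
have Hc0 := H0 c.
have hgt := height_defect_le g C L (H c) _ dx _ _ _ g_gt0 Hc0 rC
  bm b0 bp lp lm t2.
rewrite /Qtra1 /rest_state (Qscheme_step_rest g dx dt (fun i => H (x i)))//.
rewrite !height_vec2 !flow_vec2 db; set k := H (x j) + dt / dx / 2 * _.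
have kH : `|k - H (x j)| <= height_const g C L (H c) * dx ^+ 2.
  by rewrite /k [H (x j) + _]addrC addrK.
split; first by rewrite (le_trans kH)// ler_wpM2r ?sqr_ge0// le_max lexx.
have dx01 : 0 < dx <= 1 by rewrite dx0.
have nonneg y : H c <= y <= L -> 0 <= y <= L.
  by move=> /andP[cy ->]; rewrite (le_trans (ltW Hc0) cy).
have flw := flow_defect_le g C L (H c) _ _ _ _ _ _ _ g_gt0 rC dx01 pL
  (nonneg _ bm) (nonneg _ bp) lp lm tp tm kH.
rewrite (_ : _ - _ =
  - (dt / dx * (g / 4 * (H (x (j + 1)) ^+ 2 - H (x (j - 1)) ^+ 2)))
  + g * derive1 H (x j) * (dt / dx * dx / 2) * (H (x j) + k)); last first.
  by rewrite divfK ?gt_eqF//; ring.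
by rewrite (le_trans flw)// ler_wpM2r ?sqr_ge0// le_max lexx orbT.
Unshelve. all: by end_near.
Qed.
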